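(* Let $d\ge2$, consider the Euclidean lattice $(\mathbb Z^d,E_d)$ and take the speed measure $\theta\equiv1$. For any $p>1$ there exists an environment of ergodic random conductances $\{\omega(e):e\in E_d\}$ on $(\mathbb Z^d,E_d)$, with law $\mathbb P$, satisfying $\mathbb E[\omega(e)^p]<\infty$ for all $e\in E_d$, such that for any $\alpha>p$ there is a constant $c\in(0,\infty)$ such that for $\mathbb P$-a.e. $\omega$ the following hold. (i) Suppose $d=2$. There exists $L_0=L_0(\omega)<\infty$ such that for all integers $L\ge L_0$ there exists $x=x(\omega)\in\mathbb Z^d$ with $d(0,x)=L$ and $$d_\theta^\omega(0,x)\le c\,d(0,x)^{1-\frac{d-1}{2\alpha}} .$$ (ii) Suppose $d\ge2$. There exists $L_0=L_0(\omega)<\infty$ such that for all integers $L\ge L_0$ there exist $x=x(\omega),\,y=y(\omega)\in[-2L,2L]^d\cap\mathbb Z^d$ with $d(x,y)=L$ and $$d_\theta^\omega(x,y)\le c\,d(x,y)^{1-\frac{d-1}{2\alpha}} .$$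
   Context: $E_d$ is the set of non-oriented nearest-neighbour bonds of $\mathbb Z^d$, and $d(x,y)$ is the graph distance on $(\mathbb Z^d,E_d)$ (while $d$ without arguments is the dimension). Conductances are positive weights $\omega(e)\in(0,\infty)$, $e\in E_d$, with $\omega(x,y)=\omega(\{x,y\})$. An environment of ergodic random conductances is a probability measure $\mathbb P$ (with expectation $\mathbb E$) on the space of configurations $\omega=\{\omega(e):e\in E_d\}$ with the product $\sigma$-algebra $\mathcal F$ which is stationary and ergodic under translations: with $(\tau_z\omega)(\{x,y\})=\omega(\{x+z,y+z\})$, one has $\mathbb P\circ\tau_x^{-1}=\mathbb P$ for all $x\in\mathbb Z^d$, and $\mathbb P[A]\in\{0,1\}$ for any $A\in\mathcal F$ with $\tau_x(A)=A$ for all $x\in\mathbb Z^d$. For a speed measure $\theta:\mathbb Z^d\to(0,\infty)$ the metric $d_\theta^\omega$ is $$d_\theta^\omega(x,y)=\inf_{\gamma}\sum_{i=0}^{l_\gamma-1}\Big(1\wedge\frac{\theta(z_i)\wedge\theta(z_{i+1})}{\omega(z_i,z_{i+1})}\Big)^{1/2},$$ the infimum being over all nearest-neighbour paths $\gamma=(z_0,\dots,z_{l_\gamma})$ with $z_0=x$, $z_{l_\gamma}=y$. Here $\theta\equiv1$ (the case of the variable speed random walk), so each summand is $(1\wedge\omega(z_i,z_{i+1})^{-1})^{1/2}$. *)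

(* Defs.v *)
From HB Require Import structures.
From mathcomp Require Import all_boot all_order all_algebra.
From mathcomp Require Import finmap.
From mathcomp Require Import all_classical all_reals all_analysis.

Set Implicit Arguments.
Unset Strict Implicit.
Unset Printing Implicit Defensive.

Import Order.TTheory GRing.Theory Num.Theory.
Import numFieldNormedType.Exports.

Local Open Scope classical_set_scope.
Local Open Scope ring_scope.

Notation lattice d := 'rV[int]_d.

Definition adjacent d : rel (lattice d) :=
  fun x y => \sum_(i < d) `|x 0 i - y 0 i| == 1.

Definition is_bond d (b : {fset lattice d}) : bool :=
  `[< exists x y : lattice d, adjacent x y /\ b = [fset x; y]%fset >].

Definition bond d : Type := {b : {fset lattice d} | is_bond b}.

(** A path [z_0, ..., z_l] from [x] to [y] is represented by its tail
    [p = [:: z_1; ...; z_l]], so that [size p] is its number of steps. *)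
Definition is_path d (x y : lattice d) (p : seq (lattice d)) : bool :=
  path (@adjacent d) x p && (last x p == y).

Definition graph_dist (R : realType) d (x y : lattice d) : R :=
  inf [set (size p)%:R | p in [set p | is_path x y p]].

Definition config (R : realType) d : Type := bond d -> {posnum R}.

HB.instance Definition _ (R : realType) d :=
  Choice.copy (config R d) (bond d -> {posnum R}).
HB.instance Definition _ (R : realType) d :=
  isPointed.Build (config R d) (fun=> 1%:pos).

(** Generators of the product sigma-algebra on [(0, +oo)^(E_d)], each factor
    carrying the trace of the Borel sigma-algebra of [R]. *)
Definition coordinate_events (R : realType) d : set (set (config R d)) :=
  \bigcup_(e : bond d)
    preimage_set_system setT (fun w : config R d => (w e)%:num)
      (measurable : set (set R)).

Definition config_space (R : realType) d :=
  g_sigma_algebraType (@coordinate_events R d).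

Lemma is_bond_translate d (z : lattice d) (b : bond d) :
  is_bond [fset (a + z)%R | a in (val b : {fset lattice d})]%fset.
Proof.
case: b => b /= /asboolP[x [y [xy ->]]]; apply/asboolP.
exists (x + z), (y + z); split.
  rewrite /adjacent; under eq_bigr do rewrite !mxE opprD addrACA subrr addr0.
  exact: xy.
apply/fsetP => a; rewrite !inE; apply/imfsetP/orP => [[c /=] | ].
  by rewrite !inE => /orP[]/eqP-> ->; [left|right].
by case=> /eqP->; [exists x|exists y]; rewrite //= !inE eqxx ?orbT.
Qed.

Definition translate_bond d (z : lattice d) (b : bond d) : bond d :=
  exist (@is_bond d) _ (is_bond_translate z b).

Definition translate (R : realType) d (z : lattice d) (w : config R d) :
    config R d :=
  fun b => w (translate_bond z b).

Definition stationary (R : realType) d (P : probability (config_space R d) R) :=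
  forall (z : lattice d) (A : set (config_space R d)), measurable A ->
    P (translate z @^-1` A) = P A.

Definition ergodic (R : realType) d (P : probability (config_space R d) R) :=
  forall A : set (config_space R d), measurable A ->
    (forall z : lattice d, translate z @` A = A) ->
    P A = 0%E \/ P A = 1%E.

(** The value [0] off the bonds is irrelevant: [conductance] is only evaluated
    along nearest-neighbour paths. *)
Definition conductance (R : realType) d (w : config R d) (x y : lattice d) : R :=
  if (insub [fset x; y]%fset : option (bond d)) is Some e then (w e)%:num else 0.

Definition path_length (R : realType) d (theta : lattice d -> {posnum R})
    (w : config R d) (x : lattice d) (p : seq (lattice d)) : R :=
  \sum_(i < size p)
    let u := nth 0 (x :: p) i in
    let v := nth 0 (x :: p) i.+1 in
    Num.sqrt (Num.min 1
      (Num.min (theta u)%:num (theta v)%:num / conductance w u v)).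

Definition theta_dist (R : realType) d (theta : lattice d -> {posnum R})
    (w : config R d) (x y : lattice d) : R :=
  inf [set path_length theta w x p | p in [set p | is_path x y p]].

(* Main.v *)
(** The environment is a function of a Haar-distributed element [U] of the
    compact group [(Z_2)^d] of [d]-tuples of 2-adic integers, on which [Z^d] acts
    by translation; the action is ergodic because an invariant event meets all
    the cylinders of a given level with the same probability, hence is
    independent of every cylinder, and so of itself.  The line through [x] in
    direction [e_i] has level [n] if [U_j + x_j] has 2-adic valuation exactly
    [n] for all [j != i], an event of probability [2^-((n+1)(d-1))]; its bonds
    then get the conductance [(2^((n+1)(d-1)) / ((n+1)(n+2)))^(1/p)], which makes
    the [p]-th moment summable.  Every cube of side [2^(n+1)] is crossed by a
    line of level [n] in each direction, and following such a line for
    [L ~ 2^n] steps costs at most [C L^(1-(d-1)/(2 alpha))]: this is (ii).  For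
    (i), move from the origin to a line of level 0, along it to a line of level
    1 in the other direction, and so on up to level [log_2 L]; the costs grow
    geometrically because [1 - 1/(2 alpha) > 0].  All steps point in positive
    coordinate directions, so the [L]-th vertex is at distance [L]. *)
Require Import Defs.
From HB Require Import structures.
From mathcomp Require Import all_boot all_order all_algebra.
From mathcomp Require Import finmap.
From mathcomp Require Import all_classical all_reals all_analysis.
From mathcomp Require Import measurable_realfun.
From mathcomp Require Import ring lra zify.

Import Order.TTheory GRing.Theory Num.Theory.
Import numFieldNormedType.Exports.

Local Open Scope classical_set_scope.
Local Open Scope ring_scope.

Set Implicit Arguments.
Unset Strict Implicit.

(** * Events defined by countable quantifiers *)

Section measurable_predicates.
Variables (disp : measure_display) (T : measurableType disp).

Lemma measurable_const_pred (Q : Prop) : measurable [set t : T | Q].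
Proof.
have [q|q] := pselect Q.
  by rewrite (_ : mkset _ = setT)//; apply/seteqP; split.
by rewrite (_ : mkset _ = set0)//; apply/seteqP; split.
Qed.

Lemma measurable_exists (I : countType) (Q : I -> T -> Prop) :
  (forall i, measurable [set t | Q i t]) -> measurable [set t | exists i, Q i t].
Proof.
move=> mQ; rewrite (_ : mkset _ = \bigcup_i [set t | Q i t]).
  by apply: countable_bigcupT_measurable => //; exact: countableP.
by apply/seteqP; split=> t [i]; [exists i|exists i].
Qed.

Lemma measurable_forall (I : countType) (Q : I -> T -> Prop) :
  (forall i, measurable [set t | Q i t]) -> measurable [set t | forall i, Q i t].
Proof.
move=> mQ; rewrite (_ : mkset _ = ~` [set t | exists i, ~ Q i t]).
  by apply/measurableC/measurable_exists => i; exact: measurableC (mQ i).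
apply/seteqP; split=> t /=; first by move=> h [i]; apply.
by move=> h i; apply: contrapT => hi; apply: h; exists i.
Qed.

End measurable_predicates.

(** * Binary digits of a uniform variable *)

(** For [u] in [[0, 1)] this is the binary digit of weight [2^-(m+1)]. *)
Definition bit {R : realType} (m : nat) (u : R) : int :=
  (Num.floor (2 ^+ m.+1 * u) %% 2)%Z.

Fixpoint prefix_val (beta : nat -> int) (m : nat) : int :=
  if m is m'.+1 then 2 * prefix_val beta m' + beta m' else 0.

Lemma floor_double (R : realType) (x : R) :
  Num.floor (2 * x) = 2 * Num.floor x + (Num.floor (2 * x) %% 2)%Z.
Proof.
suff -> : Num.floor x = (Num.floor (2 * x) %/ 2)%Z.
  by rewrite [2 * (_ %/ _)%Z]mulrC -divz_eq.
have /andP[h1 h2] := floor_itv (2 * x).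
have h3 := divz_eq (Num.floor (2 * x)) 2.
have h4 : (0 <= (Num.floor (2 * x) %% 2)%Z < 2)%R.
  by rewrite modz_ge0 //= ltz_pmod.
move: (_ %/ _)%Z (_ %% _)%Z h3 h4 => q r h3 h4.
apply/floor_def; move: h1 h2; rewrite h3 !intrD !intrM => h1 h2.
case/andP: h4 => h4 h5.
have {}h4 : 0 <= (r%:~R : R) by rewrite ler0z.
have {}h5 : (r%:~R : R) <= 1 by rewrite (_ : 1 = 1%:~R) // ler_int; lia.
by apply/andP; split; lra.
Qed.

(** Doubling appends one binary digit to the floor, and a digit in [{0, 1}] is recovered from the
    parity. Hence prescribing the first [M] digits confines [u] to one dyadic interval of length
    [2^-M]. *)
Lemma bit_prefixP (R : realType) (beta : nat -> int) (M : nat) (u : R) :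
  (forall m, 0 <= beta m < 2) -> 0 <= u < 1 ->
  (forall m, (m < M)%N -> bit m u = beta m) <->
  Num.floor (2 ^+ M * u) = prefix_val beta M.
Proof.
move=> hb hu; elim: M => [|M IH] /=.
  split=> // _; apply/floor_def; rewrite expr0 mul1r; lra.
have E := floor_double (2 ^+ M * u); rewrite mulrA -exprS in E.
have hbM := hb M.
rewrite -/(bit M u) in E; split.
  move=> h; have h1 : forall m, (m < M)%N -> bit m u = beta m.
    by move=> m mM; apply: h; rewrite ltnS ltnW.
  by move/IH: h1 => <-; rewrite E (h M).
move=> h.
have /andP[b0 b1] : 0 <= bit M u < 2 by rewrite modz_ge0 //= ltz_pmod.
have [hM hbi] : Num.floor (2 ^+ M * u) = prefix_val beta M /\ bit M u = beta M.
  by lia.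
move=> m; rewrite ltnS leq_eqVlt => /predU1P[-> //|].
by move/IH: hM; exact.
Qed.

Lemma prefix_val_bound (beta : nat -> int) (M : nat) :
  (forall m, 0 <= beta m < 2) -> 0 <= prefix_val beta M < 2 ^+ M.
Proof.
move=> hb; elim: M => [|M IH] //=; have := hb M.
by rewrite exprS; move: (2 ^+ M : int) (prefix_val beta M) (beta M) IH; lia.
Qed.

Section unit_interval.
Variable R : realType.
Local Notation mu := (@lebesgue_measure R).

Definition unit_measure : set (measurableTypeR R) -> \bar R :=
  mrestr mu (measurable_itv `[0 : R, 1[).

HB.instance Definition _ := Measure.on unit_measure.

Lemma unit_measure_setT : unit_measure setT = 1%E.
Proof.
rewrite /unit_measure /mrestr setTI lebesgue_measure_itv /= lte_fin ltr01.
by rewrite sube0.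
Qed.

HB.instance Definition _ :=
  Measure_isProbability.Build _ _ R unit_measure unit_measure_setT.

Lemma measurable_bit m (k : int) : measurable [set u : R | bit m u = k].
Proof.
have mfloor (l : int) : measurable [set u : R | Num.floor (2 ^+ m.+1 * u) = l].
  rewrite (_ : mkset _ = `[l%:~R / 2 ^+ m.+1, (l + 1)%:~R / 2 ^+ m.+1[%classic).
    exact: measurable_itv.
  apply/seteqP; split=> u /=; rewrite in_itv /= ler_pdivrMr ?exprn_gt0//.
    by move=> <-; rewrite ltr_pdivlMr ?exprn_gt0// mulrC; exact: floor_itv.
  by rewrite ltr_pdivlMr ?exprn_gt0// mulrC => /floor_def.
rewrite (_ : mkset _ = [set u : R | exists l : int,
    (l %% 2)%Z = k /\ Num.floor (2 ^+ m.+1 * u) = l]).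
  apply: measurable_exists => l; apply: measurableI; last exact: mfloor.
  exact: measurable_const_pred.
apply/seteqP; split => [u /= h|u /= [l [<- <-]]] //.
by exists (Num.floor (2 ^+ m.+1 * u)).
Qed.

Lemma unit_measure_prefix (beta : nat -> int) (M : nat) :
  (forall m, 0 <= beta m < 2) ->
  unit_measure [set u : R | forall m, (m < M)%N -> bit m u = beta m] =
  ((2 ^+ M)^-1)%:E.
Proof.
move=> hb; rewrite /unit_measure /mrestr.
have M0 : 0 < 2 ^+ M :> R by rewrite exprn_gt0.
set q := prefix_val beta M.
(* This bound keeps the dyadic interval inside [[0, 1)], so restricting Lebesgue measure does not
   cut it. *)
have /andP[q0 qM] := prefix_val_bound M hb.
rewrite (_ : _ `&` _ = `[q%:~R / 2 ^+ M, (q + 1)%:~R / 2 ^+ M[%classic); last first.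
  apply/seteqP; split=> u /=; rewrite !in_itv /=.
    move=> [h hu]; move/(bit_prefixP _ hb hu) : h => h.
    rewrite ler_pdivrMr// ltr_pdivlMr// mulrC -/q /q -h; exact: floor_itv.
  move=> h; have hu : 0 <= u < 1.
    case/andP: h => h1 h2; apply/andP; split.
      by apply: le_trans h1; rewrite divr_ge0 ?ler0z// ltW.
    apply: (lt_le_trans h2); rewrite ler_pdivrMr// mul1r.
    rewrite (_ : 2 ^+ M = (2 ^+ M : int)%:~R); first by rewrite ler_int; lia.
    by rewrite rmorphXn.
  split=> //; apply/(bit_prefixP _ hb hu); apply: floor_def.
  by move: h; rewrite ler_pdivrMr// ltr_pdivlMr// mulrC.
rewrite lebesgue_measure_itv /= lte_fin ltr_pM2r ?invr_gt0// ltr_int.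
rewrite ltrDl ltr01 -EFinB -mulrBl -intrB.
by rewrite [q + 1]addrC addrK mul1r.
Qed.

End unit_interval.

(** * The odometer on d-tuples of 2-adic integers *)

(** Induction from the lowest digit: parity determines [b 0], and the rest is divided by 2. Division
    rounds down, so for negative [a] the right side still lists its 2-adic digits. *)
Lemma dvdz_binary (n : nat) (a : int) (b : nat -> int) :
  (forall k, 0 <= b k < 2) ->
  (2 ^+ n %| \sum_(k < n) 2 ^+ k * b k - a)%Z <->
  (forall k, (k < n)%N -> b k = ((a %/ 2 ^+ k)%Z %% 2)%Z).
Proof.
elim: n a b => [|n IH] a b hb; first by rewrite expr0 dvd1z.
have E : \sum_(k < n.+1) 2 ^+ k * b k - a =
    2 * (\sum_(k < n) 2 ^+ k * b k.+1 - (a %/ 2)%Z) + (b 0%N - (a %% 2)%Z).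
  rewrite big_ord_recl expr0 mul1r.
  under eq_bigr do rewrite lift0 exprS -mulrA.
  rewrite -mulr_sumr {1}(divz_eq a 2); ring.
have IH' := IH (a %/ 2)%Z (fun k => b k.+1) (fun k => hb k.+1).
have hdiv k : ((a %/ 2)%Z %/ 2 ^+ k)%Z = (a %/ 2 ^+ k.+1)%Z.
  by rewrite exprS divzMA_ge0.
have hr : 0 <= (a %% 2)%Z < 2 by rewrite modz_ge0 //= ltz_pmod.
have hb0 := hb 0%N; rewrite E; split.
  move=> h; have b0 : b 0%N = (a %% 2)%Z.
    case/dvdzP: h => q; rewrite exprS mulrCA.
    have key (t A u r : int) : 0 <= u < 2 -> 0 <= r < 2 ->
      2 * A + (u - r) = 2 * t -> u = r by lia.
    exact: key.
  move: h; rewrite b0 subrr addr0 exprS dvdz_mul2l // => /IH' h [|k] hk.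
    by rewrite expr0 divz1.
  by rewrite -hdiv h.
move=> h; have -> : b 0%N = (a %% 2)%Z by rewrite h // expr0 divz1.
rewrite subrr addr0 exprS dvdz_mul2l //; apply/IH' => k hk.
by rewrite h // hdiv.
Qed.

Section odometer.
Variable d : nat.
Implicit Types (n m : nat) (a b x y z : lattice d).

Definition congr_pow2 n x y : bool := [forall j, (2 ^+ n %| x 0%R j - y 0%R j)%Z].

Lemma congr_pow2P n x y :
  reflect (forall j, (2 ^+ n %| x 0%R j - y 0%R j)%Z) (congr_pow2 n x y).
Proof. exact: forallP. Qed.

Lemma congr_pow2_refl n x : congr_pow2 n x x.
Proof. by apply/congr_pow2P => j; rewrite subrr dvdz0. Qed.

Lemma congr_pow2_sym n x y : congr_pow2 n x y = congr_pow2 n y x.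
Proof. by apply/eq_forallb => j; rewrite -rpredN opprB. Qed.

Lemma congr_pow2_trans n y x z :
  congr_pow2 n x y -> congr_pow2 n y z -> congr_pow2 n x z.
Proof.
move=> /congr_pow2P xy /congr_pow2P yz; apply/congr_pow2P => j.
by rewrite -[x 0 j](subrK (y 0 j)) -addrA rpredD.
Qed.

Lemma congr_pow2_le n m x y : (n <= m)%N -> congr_pow2 m x y -> congr_pow2 n x y.
Proof.
move=> nm /congr_pow2P h; apply/congr_pow2P => j; apply: dvdz_trans (h j).
exact: dvdz_exp2l.
Qed.

Lemma congr_pow2Dr n z x y : congr_pow2 n (x + z) y = congr_pow2 n x (y - z).
Proof. by apply/eq_forallb => j; rewrite !mxE opprB addrA. Qed.

(** [s : digits] stands for the 2-adic vector [\sum_k 2 ^+ k *: s k]; the digits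
    are arbitrary integer vectors, so that translations act without carry. *)
Definition digits := nat -> lattice d.

HB.instance Definition _ := Choice.copy digits (nat -> lattice d).
HB.instance Definition _ := isPointed.Build digits (fun=> 0).

(** A partial sum representing the 2-adic vector modulo [2^n]; only its class under [congr_pow2 n]
    is meaningful. *)
Definition residue n (s : digits) : lattice d := \sum_(k < n) 2 ^+ k *: s k.

Lemma residue_congr n m (s : digits) :
  (n <= m)%N -> congr_pow2 n (residue m s) (residue n s).
Proof.
elim: m => [|m IH]; first by rewrite leqn0 => /eqP->; exact: congr_pow2_refl.
rewrite leq_eqVlt ltnS => /predU1P[->|nm]; first exact: congr_pow2_refl.
apply: congr_pow2_trans (IH nm); apply/congr_pow2P => j.
rewrite /residue big_ord_recr /= [X in X - _]mxE addrAC subrr add0r mxE.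
by rewrite dvdz_mulr// dvdz_exp2l.
Qed.

Definition cylinder n a : set digits := [set s | congr_pow2 n (residue n s) a].

(** The empty set is included to make the family a pi-system. *)
Definition cylinders : set (set digits) :=
  [set A | A = set0 \/ exists n a, A = cylinder n a].

Lemma cylinder0 a : cylinder 0 a = setT.
Proof.
by apply/seteqP; split=> // s _; apply/congr_pow2P => j; rewrite expr0 dvd1z.
Qed.

(** Cylinders are balls of the 2-adic ultrametric, hence nested or disjoint: the finer residue
    determines the coarser one. *)
Lemma cylinderI n m a b : (n <= m)%N ->
  cylinder n a `&` cylinder m b = if congr_pow2 n b a then cylinder m b else set0.
Proof.
move=> nm; have key s : cylinder m b s -> congr_pow2 n (residue n s) b.
  move=> /(congr_pow2_le nm); apply: congr_pow2_trans.
  by rewrite congr_pow2_sym residue_congr.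
case: ifPn => [ba|/negP ba]; apply/seteqP; split=> s //=; try by case.
  move=> sb; split=> //; exact: congr_pow2_trans (key _ sb) ba.
move=> [sa /key sb]; apply: ba; apply: congr_pow2_trans sa.
by rewrite congr_pow2_sym.
Qed.

Lemma cylinders_setI : setI_closed cylinders.
Proof.
move=> A B [->|[n [a ->]]]; first by rewrite set0I => _; left.
case=> [->|[m [b ->]]]; first by rewrite setI0; left.
have [nm|/ltnW nm] := leqP n m; last rewrite setIC.
  by rewrite cylinderI//; case: ifP => _; [right; exists m, b|left].
by rewrite cylinderI//; case: ifP => _; [right; exists n, a|left].
Qed.

Definition odometer := g_sigma_algebraType cylinders.

Lemma measurable_cylinder n a : measurable (cylinder n a : set odometer).
Proof. by apply: sub_sigma_algebra; right; exists n, a. Qed.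

Definition shift z (s : digits) : digits :=
  fun k => if k is k'.+1 then s k else s k + z.

Lemma residue_shift n z s : residue n.+1 (shift z s) = residue n.+1 s + z.
Proof. by rewrite /residue !big_ord_recl /= !expr0 !scale1r addrAC. Qed.

Lemma preimage_shift_cylinder n a z :
  shift z @^-1` cylinder n a = cylinder n (a - z).
Proof.
(* [residue 0] reads no digit and does not see [shift], but a congruence modulo 1 always holds. *)
case: n => [|n]; first by rewrite !cylinder0.
by apply/seteqP; split => s; rewrite /= /cylinder /= residue_shift congr_pow2Dr.
Qed.

Lemma measurable_shift z :
  measurable_fun setT (shift z : odometer -> odometer).
Proof.
apply: (measurability (cylinders : set (set odometer))) => //.
move=> _ [A [->|[n [a ->]]] <-]; first by rewrite preimage_set0 setI0.
by rewrite setTI preimage_shift_cylinder; exact: measurable_cylinder.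
Qed.

End odometer.

Arguments cylinders d : clear implicits.

(** * Shift-invariant measures on the odometer and ergodicity *)

Lemma dvdz_sub_small (B x y : int) :
  0 <= x < B -> 0 <= y < B -> (B %| x - y)%Z -> x = y.
Proof.
move=> hx hy /dvdzP[q hq]; have h1 : -1 * B < q * B by lia.
have h2 : q * B < 1 * B by lia.
rewrite !ltr_pM2r in h1 h2; [|lia..].
have q0 : q = 0 by lia.
by rewrite q0 in hq; lia.
Qed.

Section invariant_measures.
Variables (R : realType) (d : nat).
Local Notation Omega := (odometer d).

(** Uniqueness on a generating pi-system; the cylinder of level 0 is the whole space and serves as
    exhausting sequence. *)
Lemma odometer_measure_unique (m1 m2 : {measure set Omega -> \bar R}) :
  (m1 setT < +oo)%E ->
  (forall n a, m1 (cylinder n a) = m2 (cylinder n a)) ->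
  forall A, measurable A -> m1 A = m2 A.
Proof.
move=> fin eq12; apply: (@measure_unique _ R _ (cylinders d : set (set Omega)) (fun=> setT)) => //.
- exact: cylinders_setI.
- by move=> _; right; exists 0%N, 0; rewrite cylinder0.
- by rewrite bigcup_const.
- by move=> A [->|[n [a ->]]]; rewrite ?measure0.
Qed.

Definition shift_invariant (m : {measure set Omega -> \bar R}) :=
  forall z (A : set Omega), measurable A -> m (shift z @^-1` A) = m A.

(** The [(2^n)^d] cylinders of level [n] partition the space and are translates of one another, so
    they have equal mass. The measure is only assumed finite: this is also applied to the
    restriction of a probability to an invariant event. *)
Lemma shift_invariant_cylinder (m : {measure set Omega -> \bar R}) n a :
  (m setT < +oo)%E -> shift_invariant m ->
  m setT = (((2 ^ n) ^ d)%:R%:E * m (cylinder n a))%E.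
Proof.
move=> fin inv; pose T := {ffun 'I_d -> 'I_(2 ^ n)}.
have const b : m (cylinder n b) = m (cylinder n a).
  rewrite -(inv (a - b) (cylinder n a)); last exact: measurable_cylinder.
  by rewrite preimage_shift_cylinder opprB addrC subrK.
pose F (t : T) : set Omega := cylinder n (\row_j (t j : int)).
have cover : setT = \bigcup_(t in setT) F t.
  apply/seteqP; split=> // s _.
  have hr j : (`|(residue n s 0%R j %% 2 ^+ n)%Z| < 2 ^ n)%N.
    have := ltz_pmod (residue n s 0%R j) (exprn_gt0 n (ltr0Sn int 1)).
    have := modz_ge0 (residue n s 0%R j) (d := 2 ^+ n).
    rewrite expf_neq0// => /(_ isT).
    rewrite -ltz_nat => h0 h1; rewrite gez0_abs// (lt_le_trans h1)//.
    by rewrite -natz natrX.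
  exists [ffun j => Ordinal (hr j)] => //; apply/congr_pow2P => j.
  rewrite mxE ffunE /= gez0_abs ?modz_ge0 ?expf_neq0//.
  by rewrite {1}(divz_eq (residue n s 0%R j) (2 ^+ n)) addrK dvdz_mull.
have triv : trivIset setT F.
  apply/trivIsetP => t u _ _ tu.
  rewrite /F cylinderI//; case: ifP => // /congr_pow2P h.
  have bnd (v : 'I_(2 ^ n)) : 0 <= (v : int) < 2 ^+ n.
    by have := ltn_ord v; rewrite -ltz_nat -[X in _ < X]natz natrX.
  case/eqP: tu; apply/ffunP => j; apply/val_inj.
  have := h j; rewrite !mxE => /(dvdz_sub_small (bnd _) (bnd _)).
  by case.
rewrite {1}cover measure_fin_bigcup//; last 2 first.
- exact: finite_finset.
- by move=> t _; exact: measurable_cylinder.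
rewrite (_ : setT = [set` enum T]); last first.
  by apply/seteqP; split=> t //= _; rewrite mem_enum.
rewrite -fsbig_seq ?enum_uniq// big_enum /=.
under eq_bigr do rewrite const.
have finC : m (cylinder n a) \is a fin_num.
  rewrite ge0_fin_numE//; apply: le_lt_trans fin.
  by apply: le_measure; rewrite ?inE//; exact: measurable_cylinder.
rewrite -(fineK finC) sumEFin sumr_const -EFinM mulr_natl.
by rewrite card_ffun !card_ord.
Qed.

(** Compare [mu1], the restriction of [P] to [B], with [mu2 = P(B) P]. Both give all cylinders of a
    level equal mass and have the same total mass, so they agree; at [B] this reads
    [P(B) = P(B)^2]. *)
Lemma shift_invariant_ergodic (P : probability Omega R) (B : set Omega) :
  shift_invariant P -> measurable B -> (forall z, shift z @^-1` B = B) ->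
  P B = 0%E \/ P B = 1%E.
Proof.
move=> inv mB hB.
have PBfin : P B \is a fin_num by exact: fin_num_measure.
have PB0 : 0 <= fine (P B) by rewrite fine_ge0.
pose mu1 : {measure set Omega -> \bar R} := mrestr P mB.
pose mu2 : {measure set Omega -> \bar R} := mscale (NngNum PB0) P.
have inv1 : shift_invariant mu1.
  move=> z A mA; rewrite /mu1 /= /mrestr -{1}(hB z) -preimage_setI inv//.
  exact: measurableI.
have fin1 : (mu1 setT < +oo)%E.
  by rewrite /mu1 /= /mrestr setTI ltey_eq PBfin.
have finP : (P setT < +oo)%E by rewrite probability_setT ltry.
have : mu1 B = mu2 B.
  apply: odometer_measure_unique => // n a.
  have h1 := shift_invariant_cylinder n a fin1 inv1.
  have h2 : 1%E = (((2 ^ n) ^ d)%:R%:E * P (cylinder n a))%E.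
    by rewrite -(probability_setT P); exact: shift_invariant_cylinder finP inv.
  have f1 : mu1 (cylinder n a) \is a fin_num.
    by apply: fin_num_measure; exact: measurable_cylinder.
  have f2 : P (cylinder n a) \is a fin_num.
    by apply: fin_num_measure; exact: measurable_cylinder.
  rewrite /mu2 /= /mscale /=.
  rewrite /mu1 /= /mrestr setTI -/(mrestr P mB _) in h1.
  rewrite h1 -(fineK f2) -(fineK f1).
  have h3 : 1 = ((2 ^ n) ^ d)%:R * fine (P (cylinder n a)).
    by apply: EFin_inj; rewrite EFinM fineK.
  by rewrite -!EFinM /= mulrAC -h3 mul1r.
rewrite /mu1 /mu2 /= /mrestr /mscale /= setIid => hPB.
have h : fine (P B) = fine (P B) * fine (P B).
  by apply: EFin_inj; rewrite EFinM !fineK// {1}hPB fineK.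
rewrite -(fineK PBfin); have [->|h0] := eqVneq (fine (P B)) 0; first by left.
by right; congr EFin; apply: (mulfI h0); rewrite mulr1 -h.
Qed.

End invariant_measures.

(** * Haar measure as the law of the interleaved binary digits of a uniform variable *)

Lemma measurable_bit_prefix (R : realType) (beta : nat -> int) (M : nat) :
  measurable [set u : R | forall m, (m < M)%N -> bit m u = beta m].
Proof.
apply: measurable_forall => m.
have [mM|Mm] := ltnP m M.
  rewrite (_ : mkset _ = [set u : R | bit m u = beta m]); first exact: measurable_bit.
  by apply/seteqP; split=> u /= h //; exact: h.
by rewrite (_ : mkset _ = setT)//; apply/seteqP; split.
Qed.

Section haar.
Variables (R : realType) (d : nat).
Local Notation Omega := (odometer d).

(** The [d] coordinates share the binary digits of [u] by interleaving. *)
Definition digits_of (u : measurableTypeR R) : Omega :=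
  fun k => \row_j bit (k * d + j) u.

(** Undoes the interleaving of [digits_of]: place [m] holds the digit of order [m / d] of coordinate
    [m mod d]. The default 0 occurs only for [d = 0]. *)
Definition digit_bits (a : lattice d) (m : nat) : int :=
  if insub (m %% d)%N is Some j then ((a 0%R j %/ 2 ^+ (m %/ d))%Z %% 2)%Z else 0.

Lemma digit_bits_bound a m : 0 <= digit_bits a m < 2.
Proof.
rewrite /digit_bits; case: insub => [j|] //.
by rewrite modz_ge0 //= ltz_pmod.
Qed.

Lemma bit_bound m (u : R) : 0 <= bit m u < 2.
Proof. by rewrite modz_ge0 //= ltz_pmod. Qed.

Lemma digits_of_cylinder n a u : cylinder n a (digits_of u) <->
  (forall m, (m < n * d)%N -> bit m u = digit_bits a m).
Proof.
have res j : residue n (digits_of u) 0 j =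
    \sum_(k < n) 2 ^+ k * bit (k * d + j) u.
  by rewrite /residue summxE; apply: eq_bigr => k _; rewrite !mxE.
have binP j := dvdz_binary n (a 0 j) (b := fun k => bit (k * d + j) u)
  (fun k => bit_bound (k * d + j) u).
split.
  move=> /congr_pow2P h m mn.
  have d0 : (0 < d)%N by case: (d) mn; rewrite ?muln0.
  have hm := ltn_pmod m d0.
  have := h (Ordinal hm); rewrite res => /binP/(_ (m %/ d)%N).
  rewrite -divn_eq ltn_divLR// => /(_ mn) ->.
  by rewrite /digit_bits insubT.
move=> h; apply/congr_pow2P => j; rewrite res; apply/binP => k kn.
have d0 : (0 < d)%N by apply: leq_trans (ltn_ord j).
rewrite h; last first.
  rewrite (leq_trans (n := (k * d + d)%N))// ?ltn_add2l//.
  by rewrite addnC -mulSn leq_mul2r kn orbT.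
rewrite /digit_bits modnMDl modn_small// divnMDl// divn_small// addn0.
by rewrite valK.
Qed.

Lemma preimage_digits_of n a : digits_of @^-1` cylinder n a =
  [set u : R | forall m, (m < n * d)%N -> bit m u = digit_bits a m].
Proof. by apply/seteqP; split=> u /digits_of_cylinder. Qed.

Lemma measurable_digits_of : measurable_fun setT digits_of.
Proof.
apply: (measurability (cylinders d : set (set Omega))) => //.
move=> _ [A [->|[n [a ->]]] <-]; first by rewrite preimage_set0 setI0.
by rewrite setTI preimage_digits_of; exact: measurable_bit_prefix.
Qed.

HB.instance Definition _ :=
  isMeasurableFun.Build _ _ _ _ digits_of measurable_digits_of.

Definition haar : probability Omega R := distribution (@unit_measure R) digits_of.

Lemma haar_cylinder n a : haar (cylinder n a) = ((2 ^+ (n * d))^-1)%:E.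
Proof.
rewrite /haar /= /distribution /pushforward preimage_digits_of.
by apply: unit_measure_prefix => m; exact: digit_bits_bound.
Qed.

(** [haar] and its image under [shift z] both give every cylinder of level [n] mass [2^-(nd)], and
    cylinders determine a finite measure. *)
Lemma haar_shift_invariant : shift_invariant haar.
Proof.
move=> z A mA.
have mz : measurable_fun setT (shift z : Omega -> Omega).
  exact: measurable_shift.
pose X : {mfun Omega >-> Omega} := mfun_Sub (mem_set mz).
have := @odometer_measure_unique R d (distribution haar X) haar.
rewrite /distribution /pushforward /= preimage_setT probability_setT; apply => //.
  by rewrite ltry.
move=> n a; rewrite preimage_shift_cylinder.
exact: etrans (haar_cylinder _ _) (esym (haar_cylinder _ _)).
Qed.

End haar.

(** * The environment *)

Lemma adjacent_coord d (x y : lattice d) : Defs.adjacent x y ->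
  exists2 i, x 0 i != y 0 i & forall j, j != i -> x 0 j = y 0 j.
Proof.
rewrite /Defs.adjacent => /eqP xy.
have [/existsP[i xyi]|/existsPn h] := boolP [exists i, x 0 i != y 0 i].
  exists i => // j ji; apply/eqP; rewrite -subr_eq0 -normr_eq0; apply/eqP.
  have : \sum_(k | k != i) `|x 0 k - y 0 k| = 0.
    have : 0 < `|x 0 i - y 0 i| by rewrite normr_gt0 subr_eq0.
    have : 0 <= \sum_(k | k != i) `|x 0 k - y 0 k| by exact: sumr_ge0.
    move: xy; rewrite (bigD1 i) //=.
    by move: (bigop _ _ _) (`|_|) => S A; lia.
  by move/psumr_eq0P; apply.
by move: xy; rewrite big1// => i _; rewrite (eqP (negbNE (h i))) subrr normr0.
Qed.

Lemma translate_bondK d (z : lattice d) (b : bond d) :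
  translate_bond z (translate_bond (- z) b) = b.
Proof.
apply/val_inj/fsetP => a; apply/imfsetP/idP => [[c /imfsetP[e /= eb ->]] ->|ab].
  by rewrite subrK.
by exists (a - z); rewrite ?subrK//=; apply/imfsetP; exists a.
Qed.

Lemma translate_inj (R : realType) d (z : lattice d) :
  injective (@translate R d z).
Proof.
move=> w1 w2 h; apply/funext => b.
by have := congr1 (@^~ (translate_bond (- z) b)) h; rewrite /translate translate_bondK.
Qed.

Lemma measurable_coordinate (R : realType) d (e : bond d) :
  measurable_fun setT (fun w : config_space R d => (w e)%:num).
Proof.
move=> _ Y mY; rewrite setTI; apply: sub_sigma_algebra.
by exists e => //; exists Y => //; rewrite setTI.
Qed.

Section environment.
Variables (R : realType) (d : nat) (g : nat -> {posnum R}).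
Hypothesis hd : (2 <= d)%N.
Local Notation Omega := (odometer d).
Implicit Types (s : Omega) (b : bond d) (x y z : lattice d).

(** The coordinates [j] with [x 0 j = y 0 j] are those other than the direction of
    the bond [b = {x, y}]; for each of them, [U_j + x_j] has valuation [n]. *)
Definition on_level n s b : Prop :=
  forall x y, x \in val b -> y \in val b -> x != y ->
  forall j, x 0 j = y 0 j -> (2 ^+ n.+1 %| residue n.+1 s 0%R j + x 0%R j - 2 ^+ n)%Z.

Lemma on_level_shift n s z b :
  on_level n (shift z s) b <-> on_level n s (translate_bond z b).
Proof.
split=> h.
  move=> _ _ /imfsetP[x /= xb ->] /imfsetP[y /= yb ->].
  rewrite (inj_eq (addIr z)) => xy j; rewrite !mxE => /addIr xyj.
  have := h x y xb yb xy j xyj.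
  by rewrite residue_shift mxE; congr (_ %| _)%Z; ring.
move=> x y xb yb xy j xyj; rewrite residue_shift mxE.
have zb v : v \in val b -> v + z \in val (translate_bond z b).
  by move=> vb; apply/imfsetP; exists v.
have := h (x + z) (y + z) (zb _ xb) (zb _ yb).
rewrite (inj_eq (addIr z)) => /(_ xy j); rewrite !mxE xyj => /(_ erefl); congr (_ %| _)%Z; ring.
Qed.

Lemma bond_coords b : exists x y i,
  [/\ val b = [fset x; y]%fset, x 0 i != y 0 i &
      forall j, j != i -> x 0 j = y 0 j].
Proof.
case: b => b /= /asboolP[x [y [xy ->]]].
by have [i ? ?] := adjacent_coord xy; exists x, y, i.
Qed.

Lemma on_levelP n s b x y i : val b = [fset x; y]%fset -> x 0 i != y 0 i ->
    (forall j, j != i -> x 0 j = y 0 j) ->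
  on_level n s b <->
  forall j, j != i -> (2 ^+ n.+1 %| residue n.+1 s 0%R j + x 0%R j - 2 ^+ n)%Z.
Proof.
move=> bxy xyi xyj.
have xy : x != y by apply: contra_neq xyi => ->.
split=> [h j ji|h u v]; first by apply: (h x y); rewrite ?bxy ?inE ?eqxx ?orbT// xyj.
rewrite bxy !inE => /orP[]/eqP-> /orP[]/eqP->; rewrite ?eqxx// => _ j.
  by move=> xyj'; apply: h; apply: contra_neq xyi => <-.
by move=> xyj'; rewrite xyj'; apply: h; apply: contra_neq xyi => <-.
Qed.

(** A 2-adic valuation is unique: reduced modulo [2^(n+1)], two levels [n < m] at the same
    coordinate would make [2^(n+1)] divide [2^n]. *)
Lemma on_level_unique n m s b : on_level n s b -> on_level m s b -> n = m.
Proof.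
wlog nm : n m / (n <= m)%N.
  by move=> H hn hm; have [/H->|/ltnW/H->] := leqP n m.
have [x [y [i [bxy xyi xyj]]]] := bond_coords b.
move=> /(on_levelP _ _ bxy xyi xyj) hn.
move=> /(on_levelP _ _ bxy xyi xyj) hm.
(* A coordinate transverse to the bond exists because [d >= 2]; in dimension 1 the level condition
   would be vacuous. *)
have [j ji] : exists j, j != i.
  case: (eqVneq (Ordinal (ltnW hd)) i) => [e|]; last by exists (Ordinal (ltnW hd)).
  by exists (Ordinal hd); rewrite -e.
move: nm; rewrite leq_eqVlt => /predU1P[//|nm].
have {}hn := hn _ ji; have {}hm := hm _ ji.
have /congr_pow2P/(_ j) hr := @residue_congr d n.+1 m.+1 s (ltnW nm).
have d1 : (2 ^+ n.+1 %| 2 ^+ m.+1)%Z by rewrite dvdz_exp2l// ltnS ltnW.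
have d2 : (2 ^+ n.+1 %| 2 ^+ m)%Z by rewrite dvdz_exp2l.
have {}hm := dvdz_trans d1 hm.
have : (2 ^+ n.+1 %| 2 ^+ n)%Z.
  move/dvdzP: hn => [q1 hn]; move/dvdzP: hm => [q2 hm].
  move/dvdzP: hr => [q3 hr]; move/dvdzP: d2 => [q4 d2].
  apply/dvdzP; exists (q2 - q3 - q1 + q4).
  by rewrite mulrDl !mulrBl -hn -hm -hr -d2; ring.
by rewrite dvdz_Pexp2l// ltnn.
Qed.

(** A function of the predicate [L], so that equivalent level conditions give equal values by
    extensionality. For [on_level] the chosen [n] is the only one possible; bonds without a level
    get conductance 1. *)
Definition level_value (L : nat -> Prop) : {posnum R} :=
  if pselect (exists n, L n) is left h then g (projT1 (cid h)) else 1%:pos.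

Definition environment s : config_space R d :=
  fun b => level_value (fun n => on_level n s b).

Lemma environment_level n s b : on_level n s b -> environment s b = g n.
Proof.
rewrite /environment /level_value => h; case: pselect => [h'|[]]; last by exists n.
by congr g; case: cid => m hm /=; exact: on_level_unique hm h.
Qed.

Lemma environment_no_level s b :
  (forall n, ~ on_level n s b) -> environment s b = 1%:pos.
Proof.
rewrite /environment /level_value => h; case: pselect => [h1|//].
by exfalso; case: h1 => n /h.
Qed.

Lemma environment_shift z s : environment (shift z s) = translate z (environment s).
Proof.
apply/funext => b; rewrite /translate /environment; congr level_value.
by apply: funext => n; apply: propext; exact: on_level_shift.
Qed.

(** The event depends on [s] only through its residue modulo [2^(n+1)], so it is a countable union
    of cylinders. *)
Lemma measurable_on_level n b : measurable [set s : Omega | on_level n s b].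
Proof.
have [x [y [i [bxy xyi xyj]]]] := bond_coords b.
rewrite (_ : mkset _ = [set s : Omega | exists a : lattice d,
    (forall j, j != i -> (2 ^+ n.+1 %| a 0%R j + x 0%R j - 2 ^+ n)%Z) /\
    cylinder n.+1 a s]).
  apply: measurable_exists => a; apply: measurableI.
    exact: measurable_const_pred.
  exact: measurable_cylinder.
apply/seteqP; split=> s /=.
  move/(on_levelP _ _ bxy xyi xyj) => h; exists (residue n.+1 s); split=> //.
  exact: congr_pow2_refl.
move=> [a [ha /congr_pow2P sa]]; apply/(on_levelP _ _ bxy xyi xyj) => j ji.
move: (ha j ji) (sa j) => /dvdzP[q1 h1] /dvdzP[q2 h2]; apply/dvdzP.
by exists (q1 + q2); rewrite mulrDl -h1 -h2; ring.
Qed.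

Lemma measurable_environment : measurable_fun setT environment.
Proof.
apply: (measurability (@coordinate_events R d : set (set (config_space R d)))) => //.
move=> _ [_ [b _ [Y mY <-]] <-]; rewrite !setTI.
rewrite (_ : _ @^-1` _ =
  (\bigcup_n ([set s : Omega | on_level n s b] `&` [set s | Y (g n)%:num])) `|`
  ((\bigcap_n ~` [set s : Omega | on_level n s b]) `&` [set s | Y 1])).
  apply: measurableU.
    apply: bigcupT_measurable => n; apply: measurableI.
      exact: measurable_on_level.
    exact: measurable_const_pred.
  apply: measurableI; last exact: measurable_const_pred.
  apply: bigcapT_measurable => n.
  by apply: measurableC; exact: measurable_on_level.
apply/seteqP; split=> s /=.
  have [[n hn]|h] := pselect (exists n, on_level n s b).
    by rewrite (environment_level hn)// => hY; left; exists n.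
  have {}h n : ~ on_level n s b by move=> hn; apply: h; exists n.
  by rewrite environment_no_level// => hY; right; split=> // n _; exact: h.
case=> [[n _ /= [hn hY]]|[h hY]]; first by rewrite (environment_level hn).
by rewrite environment_no_level// => n; exact: (h n I).
Qed.

Definition environment_mfun : {mfun Omega >-> config_space R d} :=
  mfun_Sub (mem_set measurable_environment).

Definition environment_law : probability (config_space R d) R :=
  distribution (haar R d) environment_mfun.

Lemma environment_lawE (A : set (config_space R d)) :
  environment_law A = haar R d (environment @^-1` A).
Proof. by []. Qed.

Lemma environment_preimage z (A : set (config_space R d)) :
  environment @^-1` (translate z @^-1` A) =
  shift z @^-1` (environment @^-1` A).
Proof. by apply/seteqP; split=> s /=; rewrite environment_shift. Qed.

Lemma measurable_preimage_environment (A : set (config_space R d)) :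
  measurable A -> measurable (environment @^-1` A).
Proof. by move=> mA; rewrite -[X in measurable X]setTI; exact: measurable_environment. Qed.

Lemma environment_stationary : stationary environment_law.
Proof.
move=> z A mA; rewrite !environment_lawE environment_preimage.
by apply: haar_shift_invariant; exact: measurable_preimage_environment.
Qed.

Lemma environment_ergodic : ergodic environment_law.
Proof.
move=> A mA hA; rewrite environment_lawE.
apply: shift_invariant_ergodic; first exact: haar_shift_invariant.
  exact: measurable_preimage_environment.
move=> z; rewrite -environment_preimage -{1}(hA z); congr (_ @^-1` _).
(* [ergodic] states invariance with images; injectivity of translations turns it into the preimage
   form. *)
apply/seteqP; split=> w /=; first by case=> v Av /translate_inj <-.
by move=> Aw; exists w.
Qed.

End environment.

(** * Probability of a level and the [p]-th moment of a conductance *)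

Section moment.
Variables (R : realType) (d : nat) (g : nat -> {posnum R}).
Hypothesis hd : (2 <= d)%N.
Local Notation Omega := (odometer d).

(** All coordinates but the direction [i] are prescribed modulo [2^(n+1)]. Splitting by the residue
    of coordinate [i] covers the event by [2^(n+1)] cylinders of mass [2^-((n+1)d)]. *)
Lemma haar_on_level_le n (b : bond d) :
  (haar R d [set s : Omega | on_level n s b] <= ((2 ^+ (n.+1 * d.-1))^-1)%:E)%E.
Proof.
have [x [y [i [bxy xyi xyj]]]] := bond_coords b.
pose a (t : nat) : lattice d :=
  \row_j if j == i then (t : int) else 2 ^+ n - x 0 j.
have mC t : measurable (cylinder n.+1 (a t) : set Omega).
  exact: measurable_cylinder.
apply: (@le_trans _ _
    (haar R d (\big[setU/set0]_(t < 2 ^ n.+1) cylinder n.+1 (a t)))).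
  apply: le_measure; rewrite ?inE; first exact: measurable_on_level.
    by apply: bigsetU_measurable => t _; exact: mC.
  move=> s /= /(on_levelP _ _ bxy xyi xyj) h.
  rewrite -(bigcup_mkord _ (fun t => cylinder n.+1 (a t))).
  set r := (residue n.+1 s 0%R i %% 2 ^+ n.+1)%Z.
  have r0 : 0 <= r by rewrite modz_ge0// expf_neq0.
  have rB : (`|r| < 2 ^ n.+1)%N.
    rewrite -ltz_nat gez0_abs// -[X in _ < X]natz natrX.
    exact: ltz_pmod.
  exists `|r|%N => //=; apply/congr_pow2P => j; rewrite mxE.
  have [->|ji] := eqVneq j i.
    rewrite gez0_abs// {1}(divz_eq (residue n.+1 s 0%R i) (2 ^+ n.+1)) addrK.
    exact: dvdz_mull.
  by have := h j ji; congr (_ %| _)%Z; ring.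
have /le_trans := Boole_inequality (haar R d)
  (fun (t : nat) (_ : (t < 2 ^ n.+1)%N) => mC t); apply.
rewrite (eq_bigr (fun=> ((2 ^+ (n.+1 * d))^-1)%:E)); last first.
  by move=> t _; exact: haar_cylinder.
rewrite sumEFin lee_fin sumr_const card_ord -[_ *+ (2 ^ _)]mulr_natl natrX.
rewrite [d in X in X <= _](_ : d = d.-1.+1); last by rewrite prednK// ltnW.
by rewrite mulnS exprD invfM mulrA divff ?mul1r ?expf_neq0.
Qed.

Lemma sum_inv_mulnS (N : nat) :
  \sum_(0 <= n < N) ((n.+1 * n.+2)%:R)^-1 = 1 - (N.+1%:R)^-1 :> R.
Proof.
elim: N => [|N IH]; first by rewrite big_geq// invr1 subrr.
rewrite big_nat_recr//= IH natrM.
have h1 : (N.+1%:R : R) != 0 by rewrite pnatr_eq0.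
have h2 : (N.+2%:R : R) != 0 by rewrite pnatr_eq0.
have h3 : (N.+2%:R : R) = N.+1%:R + 1 by rewrite -natr1.
move: h2; rewrite h3 => h2; field.
by rewrite nat1r natr1 !pnatr_eq0.
Qed.

(** Pointwise, the [p]-th power of the conductance is at most 1 plus the sum over [n] of [g n ^ p]
    times the indicator of level [n]. By the hypothesis on [g], level [n] contributes at most
    [1/((n+1)(n+2))] to the expectation; this series telescopes, so the moment is at most 2. *)
Lemma environment_moment (p : R) (e : bond d) :
  (forall n, (g n)%:num `^ p <= 2 ^+ (n.+1 * d.-1) / (n.+1 * n.+2)%:R) ->
  (\int[environment_law g hd]_w (((w e)%:num `^ p)%:E) < +oo)%E.
Proof.
move=> hg.
have mcoord := @measurable_coordinate R d e.
have mF : measurable_fun setT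
    (fun w : config_space R d => ((w e)%:num `^ p)%:E : \bar R).
  apply/measurable_EFinP; apply: (measurableT_comp (measurable_powR p) mcoord).
rewrite ge0_integral_distribution//.
have mE : measurable_fun setT
    ((fun w : config_space R d => ((w e)%:num `^ p)%:E : \bar R) \o environment_mfun g hd).
  by apply: measurableT_comp => //.
pose L n := [set s : Omega | on_level n s e].
have mL n : measurable (L n) by exact: measurable_on_level.
pose f n (s : Omega) := ((g n)%:num `^ p * \1_(L n) s)%:E.
have f0 n s : (0 <= f n s)%E by rewrite lee_fin mulr_ge0// powR_ge0.
have mf n : measurable_fun setT (f n).
  by apply/measurable_EFinP; apply: measurable_funM => //; exact: measurable_indic.
apply: (@le_lt_trans _ _
    (\int[haar R d]_s (cst 1 s + \sum_(0 <= n <oo) f n s))%E).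
  apply: ge0_le_integral => //.
  - by move=> s _; rewrite lee_fin powR_ge0.
  - apply: emeasurable_funD => //.
    by apply: ge0_emeasurable_sum.
  move=> s _ /=.
  have [[n hn]|h] := pselect (exists n, on_level n s e).
    rewrite (environment_level g hd hn)//.
    apply: (@le_trans _ _ (f n s)).
      by rewrite /f indicE mem_set// mulr1.
    apply: (@le_trans _ _ (\sum_(0 <= k <oo) f k s)%E); last by rewrite leeDr.
    apply: le_trans (nneseries_lim_ge n.+1 _) => //.
    by rewrite big_nat_recr//= leeDr// sume_ge0.
  rewrite environment_no_level; last by move=> n hn; apply: h; exists n.
  by rewrite powR1 leeDl// nneseries_ge0.
rewrite ge0_integralD//; last 2 first.
- by move=> s _; exact: nneseries_ge0.
- by apply: ge0_emeasurable_sum.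
rewrite integral_cst// [X in (_ * X + _)%E](probability_setT (haar R d)) mule1.
rewrite integral_nneseries//.
apply: (@le_lt_trans _ _ (1 + 1)%E); last exact: ltry.
apply: leeD => //; apply: lime_le.
  by apply: is_cvg_nneseries => n _ _; exact: integral_ge0.
apply: nearW => N.
apply: (@le_trans _ _ (\sum_(0 <= n < N) (((n.+1 * n.+2)%:R)^-1)%:E)%E).
  apply: lee_sum => n _; rewrite /f.
  rewrite (integralZl_indic _ (fun _ => L n))//; last first.
    by move=> h; have := powR_ge0 (g n)%:num p; rewrite leNgt h.
  rewrite integral_indic// setIT.
  apply: (@le_trans _ _ (((g n)%:num `^ p)%:E * ((2 ^+ (n.+1 * d.-1))^-1)%:E)%E).
    by apply: lee_wpmul2l (haar_on_level_le n e); rewrite lee_fin powR_ge0.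
  rewrite -EFinM lee_fin ler_pdivrMr ?exprn_gt0// mulrC; exact: hg.
by rewrite sumEFin lee_fin sum_inv_mulnS gerBl invr_ge0.
Qed.

End moment.

(** * Walks and their costs *)

Section walks.
Variable d : nat.
Local Notation unit_vec i := (delta_mx 0 i : lattice d).
Implicit Types (x y : lattice d) (l : seq 'I_d).

Definition walk x l : seq (lattice d) := scanl (fun y i => y + unit_vec i) x l.
Definition walk_end x l : lattice d := foldl (fun y i => y + unit_vec i) x l.

Lemma walk_end_nseq x i t : walk_end x (nseq t i) = x + unit_vec i *+ t.
Proof.
elim: t x => [|t IH] x /=; first by rewrite mulr0n addr0.
by rewrite IH mulrS addrA.
Qed.

Lemma adjacent_unit_vec x i : Defs.adjacent x (x + unit_vec i).
Proof.
rewrite /Defs.adjacent (bigD1 i)//= big1 => [|j ji].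
  by rewrite !mxE !eqxx /= opprD addrA subrr sub0r normrN normr1.
by rewrite !mxE (negbTE ji) andbF addr0 subrr normr0.
Qed.

Lemma is_path_walk x l : is_path x (walk_end x l) (walk x l).
Proof.
rewrite /is_path; elim: l x => [|i l IH] x /=; first by rewrite eqxx.
by have /andP[-> ->] := IH (x + unit_vec i); rewrite adjacent_unit_vec.
Qed.

(** Every step changes [coord_sum] by at most 1, and the steps of a [walk] increase
    it by exactly 1, so walks are geodesics. *)
Definition coord_sum x : int := \sum_(j < d) x 0 j.

Lemma coord_sum_path x p :
  path (@Defs.adjacent d) x p -> coord_sum (last x p) <= coord_sum x + (size p : int).
Proof.
elim: p x => [|y p IH] x /=; first by rewrite addr0.
move=> /andP[/eqP xy /IH h]; apply: (le_trans h).
have : coord_sum y - coord_sum x <= 1.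
  rewrite -xy /coord_sum -sumrB; apply: ler_sum => j _.
  by rewrite distrC; exact: ler_norm.
by rewrite intS; lia.
Qed.

Lemma coord_sum_walk x l : coord_sum (walk_end x l) = coord_sum x + (size l : int).
Proof.
elim: l x => [|i l IH] x /=; first by rewrite addr0.
rewrite IH; have -> : coord_sum (x + unit_vec i) = coord_sum x + 1.
  rewrite /coord_sum; under eq_bigr do rewrite mxE.
  rewrite big_split /=; congr (_ + _); rewrite (bigD1 i)//= big1 => [|j ji].
    by rewrite mxE !eqxx.
  by rewrite mxE (negbTE ji) andbF.
by rewrite intS addrA.
Qed.

Lemma graph_dist_walk (R : realType) x l :
  graph_dist R x (walk_end x l) = (size l)%:R.
Proof.
apply/eqP; rewrite eq_le; apply/andP; split.
  apply: ge_inf; first by exists 0 => _ [p _ <-].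
  by exists (walk x l); [exact: is_path_walk|rewrite size_scanl].
apply: lb_le_inf.
  by exists (size l)%:R; exists (walk x l); [exact: is_path_walk|rewrite size_scanl].
move=> _ [p /andP[xp /eqP px] <-]; rewrite ler_nat.
by have := coord_sum_path xp; rewrite px coord_sum_walk; lia.
Qed.

End walks.

Section costs.
Variables (R : realType) (d : nat) (w : config R d).
Local Notation unit_vec i := (delta_mx 0 i : lattice d).
Local Notation cost := (path_length (fun=> 1%:pos) w).
Implicit Types (x y k : lattice d) (l : seq 'I_d).

Lemma path_length_nil x : cost x [::] = 0.
Proof. by rewrite /path_length big_ord0. Qed.

Lemma path_length_cons x y p : cost x (y :: p) =
  Num.sqrt (Num.min 1 (conductance w x y)^-1) + cost y p.
Proof. by rewrite /path_length big_ord_recl /= minxx div1r. Qed.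

Lemma path_length_ge0 x p : 0 <= cost x p.
Proof. by apply: sumr_ge0 => i _; exact: sqrtr_ge0. Qed.

Lemma path_length_walk_cat x l1 l2 : cost x (walk x (l1 ++ l2)) =
  cost x (walk x l1) + cost (walk_end x l1) (walk (walk_end x l1) l2).
Proof.
elim: l1 x => [|i l1 IH] x /=; first by rewrite path_length_nil add0r.
by rewrite !path_length_cons IH addrA.
Qed.

Lemma path_length_walk_size x l : cost x (walk x l) <= (size l)%:R.
Proof.
elim: l x => [|i l IH] x /=; first by rewrite path_length_nil.
rewrite path_length_cons -nat1r; apply: lerD (IH _).
by rewrite -[leRHS]sqrtr1; apply: ler_wsqrtr; rewrite ge_min lexx.
Qed.

Lemma theta_dist_walk x l :
  theta_dist (fun=> 1%:pos) w x (walk_end x l) <= cost x (walk x l).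
Proof.
apply: ge_inf; first by exists 0 => _ [p _ <-]; exact: path_length_ge0.
by exists (walk x l) => //; exact: is_path_walk.
Qed.

Definition ray (i : 'I_d) (c : R) k : Prop := forall t : nat,
  conductance w (k + unit_vec i *+ t) (k + unit_vec i *+ t.+1) = c.

Lemma ray_translate i c k t : ray i c k -> ray i c (k + unit_vec i *+ t).
Proof. by move=> h s; rewrite -!addrA -!mulrnDr addnS; exact: h. Qed.

Lemma path_length_ray i c k t : 0 <= c -> ray i c k ->
  cost k (walk k (nseq t i)) <= t%:R * (Num.sqrt c)^-1.
Proof.
move=> c0; elim: t k => [|t IH] k h /=; first by rewrite path_length_nil mul0r.
rewrite path_length_cons -nat1r mulrDl mul1r; apply: lerD.
  have := h 0%N; rewrite mulr0n addr0 mulr1n => ->.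
  by rewrite -sqrtrV//; apply: ler_wsqrtr; rewrite ge_min lexx orbT.
by apply: IH; have := ray_translate 1%N h; rewrite mulr1n.
Qed.

Variable g : nat -> {posnum R}.

(** The property of the environment behind both distance bounds. The offset from [x] to [k] is
    nonnegative, and zero along [i], so in dimension 2 the ray is reached from [x] by positive steps
    in the other direction. *)
Definition has_rays : Prop := forall x i n, exists k,
  [/\ k 0 i = x 0 i, (forall j, x 0 j <= k 0 j <= x 0 j + 2 ^+ n.+1) &
      ray i (g n)%:num k].

End costs.

(** * Growth of the level conductances *)

Section level_conductance.
Variables (R : realType) (d : nat) (p : R).

Lemma succ_le_expr (sigma : R) : 1 < sigma ->
  exists2 K : R, 0 < K & forall n : nat, n.+1%:R <= K * sigma ^+ n.
Proof.
move=> s1; have s0 : 0 < sigma - 1 by rewrite subr_gt0.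
have K0 : 0 < (sigma - 1)^-1 by rewrite invr_gt0.
(* This [K] satisfies [K (sigma - 1) = sigma >= 1], so each further factor [sigma] raises the bound
   by at least 1. *)
exists (1 + (sigma - 1)^-1) => [|n]; first by rewrite addr_gt0.
elim: n => [|n IH]; first by rewrite expr0 mulr1 lerDl ltW.
have h1 : 1 <= sigma ^+ n by rewrite exprn_ege1// ltW.
have h2 : (sigma - 1)^-1 * (sigma - 1) = 1 by rewrite mulVf// gt_eqF.
rewrite -natr1 exprS; move: (sigma ^+ n) ((sigma - 1)^-1) h1 h2 K0 IH.
by move=> S V h1 h2 V0 IH; nra.
Qed.

(** Since [(n+1)(n+2) <= 2 (n+1)^2], it suffices to square the linear bound for [sqrt rho]. *)
Lemma mulnS_le_expr (rho : R) : 1 < rho ->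
  exists2 K : R, 0 < K & forall n : nat, (n.+1 * n.+2)%:R <= K * rho ^+ n.
Proof.
move=> r1; have s1 : 1 < Num.sqrt rho.
  by rewrite -[X in X < _]sqrtr1 ltr_sqrt// (lt_trans _ r1).
have [K K0 hK] := succ_le_expr s1.
exists (2 * K ^+ 2) => [|n]; first by rewrite mulr_gt0// exprn_gt0.
have := hK n; rewrite natrM -[n.+2%:R]natr1.
have -> : rho ^+ n = (Num.sqrt rho ^+ n) ^+ 2.
  by rewrite -exprM mulnC exprM sqr_sqrtr// ltW// (lt_trans _ r1).
have : 1 <= n.+1%:R :> R by rewrite ler1n.
by move: (Num.sqrt rho ^+ n) (n.+1%:R : R) => S N; nra.
Qed.

Definition level_weight (n : nat) : R :=
  (2 ^+ (n.+1 * d.-1) / (n.+1 * n.+2)%:R) `^ p^-1.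

Lemma level_weight_gt0 n : 0 < level_weight n.
Proof. by rewrite powR_gt0// divr_gt0 ?exprn_gt0 ?ltr0n. Qed.

Definition level_conductance (n : nat) : {posnum R} := PosNum (level_weight_gt0 n).

Lemma level_conductance_powR n : p != 0 ->
  (level_conductance n)%:num `^ p = 2 ^+ (n.+1 * d.-1) / (n.+1 * n.+2)%:R.
Proof.
by move=> p0; rewrite /= /level_weight -powRrM mulVf// powRr1.
Qed.

(** Up to the factor [((n+1)(n+2))^(1/(2p))] the left side decays like [2^(-n(d-1)/(2p))]. As
    [alpha > p], this beats the rate on the right, and the exponential gain absorbs the polynomial
    factor. *)
Lemma level_conductance_inv_sqrt (alpha : R) : (2 <= d)%N -> 1 < p -> p < alpha ->
  exists2 C : R, 0 < C & forall n,
    (Num.sqrt (level_conductance n)%:num)^-1 <=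
    C * (2 ^+ n) `^ (- ((d%:R - 1) / (2 * alpha))).
Proof.
move=> hd p1 pa; set gamma := (d%:R - 1) / (2 * alpha).
have p0 : 0 < p by apply: lt_trans p1.
have a0 : 0 < alpha by apply: lt_trans pa.
have dE : (d.-1%:R : R) = d%:R - 1 by rewrite -subn1 natrB// ltnW.
have d0 : 0 < d%:R - 1 :> R by rewrite subr_gt0 ltr1n.
(* Equal to [(d-1)(1 - p/alpha)]: the gap between the two exponents once the inequality is raised to
   the power [2p]. *)
set e : R := (d%:R - 1) - gamma * (2 * p).
have e0 : 0 < e.
  rewrite /e /gamma -mulrA -{1}[d%:R - 1]mulr1 -mulrBr mulr_gt0// subr_gt0.
  by rewrite mulrC ltr_pdivrMr ?mulr_gt0// mul1r ltr_pM2l.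
have rho1 : 1 < 2 `^ e :> R.
  rewrite -[X in X < _](_ : 1 `^ e = 1); last by rewrite powR1.
  by apply: gt0_ltr_powR; rewrite ?nnegrE// ltr1n.
have [K K0 hK] := mulnS_le_expr rho1.
exists (K `^ (2 * p)^-1) => [|n]; first exact: powR_gt0.
have two_n : 0 < 2 ^+ n :> R by rewrite exprn_gt0.
set A : R := 2 ^+ (n.+1 * d.-1); set B : R := (n.+1 * n.+2)%:R.
have A0 : 0 < A by rewrite exprn_gt0.
have B0 : 0 < B by rewrite ltr0n.
have -> : (Num.sqrt (level_conductance n)%:num)^-1 = (B / A) `^ (2 * p)^-1.
  have -> : B / A = (A / B) `^ (-1).
    by rewrite powR_inv1 ?divr_ge0 ?ltW// invf_div.
  rewrite -powR12_sqrt; last exact: powR_ge0.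
  rewrite /= /level_weight -/A -/B -!powRrM -powRN; congr (_ `^ _).
  by rewrite mulN1r invfM mulrC.
have -> : (2 ^+ n) `^ (- gamma) = (((2 ^+ n) `^ (- gamma)) `^ (2 * p)) `^ (2 * p)^-1.
  by rewrite -!powRrM mulfV ?mulr1// gt_eqF// mulr_gt0.
rewrite -powRM ?powR_ge0 ?(ltW K0)//.
apply: ge0_ler_powR; rewrite ?nnegrE ?invr_ge0 ?mulr_ge0 ?invr_ge0 ?powR_ge0 ?(ltW A0) ?(ltW B0) ?(ltW K0) ?(ltW p0)//.
rewrite ler_pdivrMr//; apply: (le_trans (hK n)); rewrite -mulrA ler_pM2l//.
have -> : (2 `^ e) ^+ n = (2 ^+ n) `^ e :> R.
  by rewrite -powR_mulrn ?powR_ge0// -powRrM mulrC powRrM powR_mulrn.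
rewrite /e powRD; last by rewrite gt_eqF ?implybT.
rewrite mulrC -powRrM mulNr ler_pM2l ?powR_gt0//.
rewrite -dE powR_mulrn ?(ltW two_n)// -exprM /A ler_eXn2l ?ltr1n//.
by rewrite leq_mul2r leqnSn orbT.
Qed.

End level_conductance.

(** * Existence of lines of every level near every point *)

Section rays_measurable.
Variables (R : realType) (d : nat).

Lemma measurable_conductance (u v : lattice d) :
  measurable_fun setT (fun w : config_space R d => conductance w u v).
Proof.
rewrite /conductance; case: insub => [e|]; last exact: measurable_cst.
exact: measurable_coordinate.
Qed.

Lemma measurable_has_rays (g : nat -> {posnum R}) :
  measurable [set w : config_space R d | has_rays w g].
Proof.
apply: measurable_forall => x; apply: measurable_forall => i.
apply: measurable_forall => n; apply: measurable_exists => k.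
rewrite (_ : mkset _ = [set w : config_space R d |
    k 0 i = x 0 i /\ forall j, x 0 j <= k 0 j <= x 0 j + 2 ^+ n.+1] `&`
    [set w | ray w i (g n)%:num k]).
  apply: measurableI; first exact: measurable_const_pred.
  apply: measurable_forall => t.
  have := measurable_conductance (k + delta_mx 0 i *+ t) (k + delta_mx 0 i *+ t.+1)
    measurableT (measurable_set1 (g n)%:num).
  by rewrite setTI.
by apply/seteqP; split=> w /= [] // [].
Qed.

(** For [j != i], coordinate [j] of [k] is the first integer from [x 0 j] on at which [U_j + k_j] is
    congruent to [2^n] modulo [2^(n+1)], that is, has valuation [n]. Moving along [e_i] preserves
    this. *)
Lemma environment_has_rays (g : nat -> {posnum R}) (hd : (2 <= d)%N)
  (s : odometer d) : has_rays (environment g s) g.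
Proof.
move=> x i n; set r := residue n.+1 s.
pose k : lattice d := \row_j
  if j == i then x 0 i else x 0 j + ((2 ^+ n - r 0%R j - x 0%R j) %% 2 ^+ n.+1)%Z.
have B0 : 0 < 2 ^+ n.+1 :> int by rewrite exprn_gt0.
exists k; split.
- by rewrite mxE eqxx.
- move=> j; rewrite mxE; case: eqP => [->|_].
    by rewrite lexx lerDl ltW.
  by rewrite lerDl lerD2l modz_ge0 ?gt_eqF//= ltW// ltz_pmod.
move=> t; set u := k + _; set v := k + _.
have vE : v = u + delta_mx 0 i by rewrite /v mulrSr addrA.
have uv : Defs.adjacent u v by rewrite vE; exact: adjacent_unit_vec.
have b : is_bond [fset u; v]%fset by apply/asboolP; exists u, v.
rewrite /conductance insubT; congr (_%:num).
apply: (environment_level _ hd).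
have ij j : j != i -> u 0 j = k 0 j.
  by move=> ji; rewrite !mxE mulmxnE !mxE (negbTE ji) andbF mul0rn addr0.
apply/(@on_levelP _ _ _ _ u v i) => //.
- rewrite vE [X in _ != X]mxE [X in _ + X]mxE !eqxx eq_sym -subr_eq0.
  by rewrite addrAC subrr add0r.
- move=> j ji; rewrite vE [RHS]mxE [X in _ + X]mxE (negbTE ji) andbF.
  by rewrite addr0.
move=> j ji; rewrite ij// mxE (negbTE ji) -/r.
have := divz_eq (2 ^+ n - r 0%R j - x 0%R j) (2 ^+ n.+1).
set m := (_ %% _)%Z; set q := (_ %/ _)%Z => h.
apply/dvdzP; exists (- q); rewrite mulNr.
by move: h; move: (q * _) (r 0 j) (x 0 j) m (2 ^+ n : int) => a b' c e f; lia.
Qed.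

Lemma environment_law_has_rays (g : nat -> {posnum R}) (hd : (2 <= d)%N) :
  {ae environment_law g hd, forall w, has_rays w g}.
Proof.
exists (~` [set w : config_space R d | has_rays w g]); split => //.
  by apply: measurableC; exact: measurable_has_rays.
rewrite environment_lawE (_ : _ @^-1` _ = set0) ?measure0//.
by apply/seteqP; split=> s //= h; apply: h; exact: environment_has_rays.
Qed.

End rays_measurable.

(** * Short walks *)

Lemma pow2_floor (m L : nat) : (0 < L)%N -> (2 ^ m <= L)%N ->
  exists n, (2 ^ (n + m) <= L < 2 ^ (n + m).+1)%N.
Proof.
move=> L0 mL; exists (trunc_log 2 L - m)%N.
have := trunc_log_bounds (isT : 1 < 2)%N L0.
by rewrite subnK// trunc_log_max.
Qed.

Lemma powR_opp_le (R : realType) (a x y gamma : R) :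
  0 <= gamma -> 0 < a -> 0 < x -> 0 < y -> y <= a * x ->
  x `^ (- gamma) <= a `^ gamma * y `^ (- gamma).
Proof.
move=> gamma0 a0 x0 y0 yax.
rewrite !powRN ler_pdivlMr ?powR_gt0// mulrC ler_pdivrMr ?powR_gt0//.
rewrite -powRM ?(ltW a0) ?(ltW x0)//.
by apply: ge0_ler_powR; rewrite // nnegrE ?mulr_ge0 ?(ltW a0) ?(ltW x0) ?(ltW y0).
Qed.

Section short_walks.
Variables (R : realType) (d : nat) (w : config R d) (g : nat -> {posnum R}).
Hypothesis rays : has_rays w g.
Variables (gamma C : R).
Hypothesis gamma_ge0 : 0 <= gamma.
Hypothesis C_gt0 : 0 < C.
Hypothesis g_large : forall n,
  (Num.sqrt (g n)%:num)^-1 <= C * (2 ^+ n) `^ (- gamma).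
Local Notation cost := (path_length (fun=> 1%:pos) w).

(** With [2^(n+1) <= L < 2^(n+2)], a ray of level [n] starts in [[0, L]^d] with coordinate [i] equal
    to 0, so its first [L] steps stay in that box. They cost at most [L C 2^(-n gamma)], and
    [L <= 4 * 2^n] yields the factor [4^gamma]. *)
Lemma short_walk_in_box (hd : (0 < d)%N) (L : nat) : (2 <= L)%N ->
  exists x y : lattice d,
    [/\ (forall i, - (2 * L%:Z) <= x 0 i <= 2 * L%:Z),
        (forall i, - (2 * L%:Z) <= y 0 i <= 2 * L%:Z),
        graph_dist R x y = L%:R &
        theta_dist (fun=> 1%:pos) w x y <=
          C * 4 `^ gamma * L%:R `^ (1 - gamma)].
Proof.
move=> L2; have L0 : (0 < L)%N by apply: leq_trans L2.
have [n /andP[]] := pow2_floor L0 (L2 : (2 ^ 1 <= L)%N); rewrite addn1 => nL Ln.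
pose i := Ordinal hd; have [k [k1 k2 k3]] := rays 0 i n.
have nL' : 2 ^+ n.+1 <= L%:Z by rewrite -natrX natz lez_nat.
have k0 j : 0 <= k 0 j <= 2 ^+ n.+1 by have := k2 j; rewrite !mxE add0r.
exists k, (walk_end k (nseq L i)); split.
- move=> j; have := k0 j; move: (2 ^+ n.+1 : int) nL' (k 0 j) => B; lia.
- move=> j; rewrite walk_end_nseq !mxE mulmxnE !mxE.
  have := k0 j; have [->|ji] := eqVneq j i; last first.
    rewrite andbF mul0rn addr0.
    by move: (2 ^+ n.+1 : int) nL' (k 0 j) => B; lia.
  rewrite k1 mxE /= => _; rewrite add0r natz; lia.
- by rewrite graph_dist_walk size_nseq.
apply: (le_trans (theta_dist_walk _ _ _)).
apply: (le_trans (path_length_ray _ _ k3)) => //.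
have L0' : 0 < L%:R :> R by rewrite ltr0n.
apply: (@le_trans _ _ (L%:R * (C * (2 ^+ n) `^ (- gamma)))).
  by rewrite ler_pM2l.
rewrite powRD; last by apply/implyP => _; rewrite gt_eqF.
rewrite powRr1 ?(ltW L0')// mulrCA -!mulrA ler_pM2l// [leRHS]mulrCA ler_pM2l//.
apply: powR_opp_le => //.
rewrite -!natrX -natrM ler_nat (leq_trans (ltnW Ln))//.
by rewrite !expnS mulnA.
Qed.

Section two_directions.
Variables (i0 i1 : 'I_d).
Hypothesis directions : forall j, (j == i0) || (j == i1).
Hypothesis gamma_lt1 : gamma < 1.

Definition direction (n : nat) : 'I_d := if odd n then i1 else i0.

(** The start [k] of a level [n] ray agrees with [x] in coordinate [direction n]. With only two
    directions available, [k] lies on the line through [x] in [direction n.+1], at most [2^(n+1)]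
    positive steps away. *)
Lemma walk_to_ray x n : exists2 t : nat, (t <= 2 ^ n.+1)%N &
  ray w (direction n) (g n)%:num (x + delta_mx 0 (direction n.+1) *+ t).
Proof.
have [k [k1 k2 k3]] := rays x (direction n) n.
set i := direction n.+1; have /andP[xk kx] := k2 i.
have t0 : 0 <= k 0 i - x 0 i by rewrite subr_ge0.
exists `|(k 0 i - x 0 i)%R|%N.
  by rewrite -lez_nat gez0_abs// lerBlDl -[X in _ + X]natz natrX.
suff -> : x + delta_mx 0 i *+ `|(k 0 i - x 0 i)%R|%N = k by [].
apply/rowP => j; rewrite !mxE mulmxnE mxE eqxx /=.
have [->|ji] := eqVneq j i; first by rewrite mulr1n natz gez0_abs// addrC subrK.
rewrite mul0rn addr0; suff -> : j = direction n by [].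
move: ji (directions j); rewrite /i /direction /=.
by case: (odd n) => /= /negbTE->; rewrite ?orbF => /eqP.
Qed.

Let kappa : R := 2 `^ (1 - gamma).

Lemma kappa_gt1 : 1 < kappa.
Proof.
rewrite /kappa -[X in X < _](_ : 1 `^ (1 - gamma) = 1); last by rewrite powR1.
by apply: gt0_ltr_powR; rewrite ?nnegrE ?subr_gt0// ltr1n.
Qed.

Lemma kappa_exprE n : kappa ^+ n = (2 ^+ n) `^ (1 - gamma).
Proof.
by rewrite /kappa -powR_mulrn ?powR_ge0// -powRrM mulrC powRrM powR_mulrn.
Qed.

Lemma ray_cost n : 2 ^+ n * (Num.sqrt (g n)%:num)^-1 <= C * kappa ^+ n.
Proof.
have two_n : 0 < 2 ^+ n :> R by rewrite exprn_gt0.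
rewrite kappa_exprE powRD; last by apply/implyP => _; rewrite gt_eqF.
by rewrite powRr1 ?(ltW two_n)// mulrCA ler_pM2l.
Qed.

(** The walk follows the ray of level [n], whose direction is also [direction n.+2], to a ray of
    level [n+1]: at most [2^(n+2)] steps, of cost at most [4 C kappa^n]. The coefficient
    [A = 4C/(kappa-1)] solves [A kappa^n + 4C kappa^n = A kappa^(n+1)]. The 2 pays for the first
    steps to a level 0 ray, each of cost at most 1. *)
Lemma walk_chain n : exists l,
  ray w (direction n) (g n)%:num (walk_end 0 l) /\
  cost 0 (walk 0 l) <= 2 + 4 * C / (kappa - 1) * kappa ^+ n.
Proof.
have k1 : 0 < kappa - 1 by rewrite subr_gt0 kappa_gt1.
elim: n => [|n [l [hl cl]]].
  have [t t2 ht] := walk_to_ray 0 0.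
  exists (nseq t (direction 1)); rewrite walk_end_nseq; split=> //.
  apply: (le_trans (path_length_walk_size _ _ _)).
  rewrite size_nseq ler_wpDr//; last by rewrite (ler_nat R t 2).
  by rewrite expr0 mulr1 divr_ge0 ?mulr_ge0 ?(ltW k1) ?(ltW C_gt0).
have [t tn ht] := walk_to_ray (walk_end 0 l) n.+1.
exists (l ++ nseq t (direction n)); split.
  rewrite /walk_end foldl_cat -/(walk_end 0 l) -/(walk_end _ _) walk_end_nseq.
  by move: ht; rewrite /direction /= negbK.
rewrite path_length_walk_cat; apply: (le_trans (lerD cl (path_length_ray _ _ hl))) => //.
have h := ray_cost n.
have ht2 : t%:R <= 4 * 2 ^+ n :> R.
  by rewrite -natrX -natrM ler_nat (leq_trans tn)// !expnS mulnA.
have E : kappa ^+ n.+1 = kappa ^+ n + (kappa - 1) * kappa ^+ n.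
  by rewrite exprS; ring.
rewrite E mulrDr addrA lerD2l mulrA divfK ?gt_eqF//.
apply: (@le_trans _ _ (4 * 2 ^+ n * (Num.sqrt (g n)%:num)^-1)).
  by rewrite ler_wpM2r// invr_ge0 sqrtr_ge0.
by rewrite -!mulrA ler_pM2l.
Qed.

(** Take the chain to level [n], where [2^n <= L < 2^(n+1)], append [L] steps on its ray, and keep
    the first [L] steps of the whole. The appended steps make the walk long enough, and truncation
    does not raise the cost. *)
Lemma short_walk_from_origin (L : nat) : (1 <= L)%N ->
  exists x : lattice d, graph_dist R 0 x = L%:R /\
    theta_dist (fun=> 1%:pos) w 0 x <=
      (2 + 4 * C / (kappa - 1) + 2 * C) * L%:R `^ (1 - gamma).
Proof.
move=> L1; have [n /andP[]] := pow2_floor L1 (L1 : (2 ^ 0 <= L)%N); rewrite addn0 => nL Ln.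
have k1 : 0 < kappa - 1 by rewrite subr_gt0 kappa_gt1.
have [l [hl cl]] := walk_chain n.
pose l' := l ++ nseq L (direction n).
have size_l' : size (take L l') = L.
  by rewrite size_takel// size_cat size_nseq leq_addl.
exists (walk_end 0 (take L l')); split.
  by rewrite graph_dist_walk size_l'.
apply: (le_trans (theta_dist_walk _ _ _)).
apply: (@le_trans _ _ (cost 0 (walk 0 l'))).
  by rewrite -[in leRHS](cat_take_drop L l') path_length_walk_cat lerDl path_length_ge0.
rewrite path_length_walk_cat.
apply: (le_trans (lerD cl (path_length_ray _ _ hl))) => //.
have h : kappa ^+ n <= L%:R `^ (1 - gamma).
  rewrite kappa_exprE; apply: ge0_ler_powR; rewrite ?nnegrE ?subr_ge0 ?(ltW gamma_lt1)//.
  by rewrite -natrX ler_nat.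
have h1 : 1 <= L%:R `^ (1 - gamma).
  by apply: le_trans h; rewrite exprn_ege1// ltW// kappa_gt1.
rewrite [leRHS]mulrDl [X in _ <= X + _]mulrDl; apply: lerD; first apply: lerD.
- by rewrite ler_peMr.
- by rewrite ler_wpM2l// divr_ge0 ?mulr_ge0 ?(ltW k1) ?(ltW C_gt0).
apply: (@le_trans _ _ (2 * (2 ^+ n * (Num.sqrt (g n)%:num)^-1))).
  rewrite mulrA ler_wpM2r ?invr_ge0 ?sqrtr_ge0//.
  by rewrite -natrX -natrM ler_nat -expnS ltnW.
rewrite -mulrA ler_pM2l//; apply: (le_trans (ray_cost n)).
by rewrite ler_pM2l.
Qed.

End two_directions.

End short_walks.

(** * The law of the environment with its moment and distance bounds *)

Unset Implicit Arguments.
Set Strict Implicit.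

Theorem theorem2p5 (R : realType) (d : nat) (hd : (2 <= d)%N)
    (p : R) (hp : 1 < p) :
  exists P : probability (config_space R d) R,
    [/\ stationary P, ergodic P,
        (forall e : bond d,
           (\int[P]_w (((w e)%:num `^ p)%:E) < +oo)%E) &
        forall alpha : R, p < alpha ->
        exists2 c : R, 0 < c &
        {ae P, forall w : config_space R d,
          (d = 2%N ->
             exists L0 : nat, forall L : nat, (L0 <= L)%N ->
             exists x : lattice d,
               graph_dist R 0 x = L%:R /\
               theta_dist (fun=> 1%:pos) w 0 x
                 <= c * graph_dist R 0 x `^ (1 - (d%:R - 1) / (2 * alpha)))
          /\
          (exists L0 : nat, forall L : nat, (L0 <= L)%N ->
             exists x y : lattice d,
               [/\ (forall i, - (2 * L%:Z) <= x 0 i <= 2 * L%:Z),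
                   (forall i, - (2 * L%:Z) <= y 0 i <= 2 * L%:Z),
                   graph_dist R x y = L%:R &
                   theta_dist (fun=> 1%:pos) w x y
                     <= c * graph_dist R x y `^ (1 - (d%:R - 1) / (2 * alpha))])}].
Proof.
pose g := level_conductance d p.
have p0 : 0 < p by apply: lt_trans hp.
exists (environment_law g hd); split.
- exact: environment_stationary.
- exact: environment_ergodic.
- move=> e; apply: environment_moment => n.
  by rewrite level_conductance_powR ?gt_eqF.
move=> alpha pa; set gamma := (d%:R - 1) / (2 * alpha).
have a0 : 0 < alpha by apply: lt_trans pa.
have [C C0 hC] := level_conductance_inv_sqrt hd hp pa.
have gamma0 : 0 <= gamma.
  by rewrite divr_ge0 ?mulr_ge0 ?(ltW a0)// subr_ge0 ler1n ltnW.
pose c1 := 2 + 4 * C / (2 `^ (1 - gamma) - 1) + 2 * C.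
have c2 : 0 < C * 4 `^ gamma by rewrite mulr_gt0// powR_gt0.
(* The constant is fixed before [d = 2] is assumed; for larger [d], [gamma] may exceed 1 and the
   sign of [c1] is not controlled, hence the absolute value. *)
exists (C * 4 `^ gamma + `|c1|); first by rewrite ltr_pwDl.
have aeP := ae_filter_ringOfSetsType (environment_law g hd).
apply: filterS (environment_law_has_rays g hd) => w hw; split.
  move=> d2; exists 1%N => L L1.
  pose i0 := Ordinal (ltnW hd); pose i1 := Ordinal hd.
  have dirs j : (j == i0) || (j == i1).
    by rewrite -!val_eqE /=; have := ltn_ord j; lia.
  (* Here [gamma = 1/(2 alpha)], and [alpha > p > 1]. *)
  have gamma1 : gamma < 1.
    by rewrite /gamma d2 ltr_pdivrMr ?mulr_gt0//; lra.
  have [x [xL hx]] := short_walk_from_origin hw C0 hC dirs gamma1 L1.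
  exists x; split=> //; rewrite xL; apply: (le_trans hx).
  apply: ler_wpM2r; first exact: powR_ge0.
  by apply: (le_trans (ler_norm _)); rewrite lerDr ltW.
exists 2%N => L L2.
have [x [y [hx hy xy hxy]]] :=
  short_walk_in_box hw gamma0 C0 hC (ltnW hd) L2.
exists x, y; split=> //; rewrite xy; apply: (le_trans hxy).
by apply: ler_wpM2r; [exact: powR_ge0|rewrite lerDl].
Qed.
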